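(* Let $B\in\mathbb{C}\setminus\{0\}$ and consider the rational difference equation $$z_{n+1}=\frac{z_{n}z_{n-1}+Bz_{n}}{B+z_{n}},\quad n=0,1,\dots,$$ with initial conditions $z_{0},z_{-1}\in\mathbb{C}$. Then its forbidden set $\mathfrak{F}$ (a set of pairs $(z_0,z_{-1})$) equals $$S_{5}=\{(-B,-B)\}\cup\left\{\left(a,\frac{B^{2}}{-4a}-B\right)\,\middle|\,a\in\left\{\tfrac{-Bn-B}{2n}\,\middle|\,n\in\mathbb{N}\right\}\right\}$$ $$\cup\bigcup_{\delta\in\mathbb{C}\setminus\left((-\infty,-\frac14]\cup\{0\}\right)}\left\{\left(a,\frac{\delta B^{2}}{a}-B\right)\,\middle|\,a\in P_\delta\setminus\{0\}\right\}\cup\bigcup_{\delta\in(-\infty,-\frac14)}\left\{\left(a,\frac{\delta B^{2}}{a}-B\right)\,\middle|\,a\in Q_\delta\setminus\{0\}\right\},$$ where $$P_\delta=\left\{-2\delta B\left(\frac{\left(1+\sqrt{1+4\delta}\right)^{n-1}-\left(1-\sqrt{1+4\delta}\right)^{n-1}}{\left(1+\sqrt{1+4\delta}\right)^{n}-\left(1-\sqrt{1+4\delta}\right)^{n}}\right)-B\,\middle|\,n\in\mathbb{N}\right\},$$ $$Q_\delta=\left\{\frac{B}{2}\left(-1-\sqrt{-4\delta-1}\,\cot\left(n\arccos\left(\tfrac{1}{2\sqrt{-\delta}}\right)\right)\right)\,\middle|\,n\in\mathbb{N}\right\}.$$ Moreover, given $(z_{0},z_{-1})\notin\mathfrak{F}$,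 one has $z_{n+1}=\frac{C}{z_{n}+B}$ for all $n\geq 0$, where $C=(z_{-1}+B)z_{0}$. This implies the following: (a) If $C=0$, then $z_{n}=0$ for all $n\geq 0$. (b) If $\frac{-C}{B^{2}}\in\mathbb{C}\setminus\left[\frac14,\infty\right)$, then with $\lambda_{1}=\frac{1-\sqrt{1+\frac{4C}{B^{2}}}}{2}$ and $\lambda_{2}=\frac{1+\sqrt{1+\frac{4C}{B^{2}}}}{2}$, $$z_{n}=B\left(\frac{(B\lambda_{2}-z_{0}-B)\lambda_{1}^{n+1}+(z_{0}+B-B\lambda_{1})\lambda_{2}^{n+1}}{(B\lambda_{2}-z_{0}-B)\lambda_{1}^{n}+(z_{0}+B-B\lambda_{1})\lambda_{2}^{n}}\right)-B,\quad n\geq 0.$$ (c) If $\frac{-C}{B^{2}}=\frac14$, then $$z_{n}=B\left(\frac{B+(n+1)(2z_{0}+B)}{2B+4nz_{0}+2nB}\right)-B,\quad n\geq 0.$$ (d) If $\frac{-C}{B^{2}}\in\left(\frac14,\infty\right)$, then with $D=B\sqrt{\frac{-4C}{B^{2}}-1}$ and $\rho=\arccos\left(\sqrt{\frac{B^{2}}{-4C}}\right)$, for all $n\geq 0$, $$z_{n}=B\sqrt{\frac{-C}{B^{2}}}\left(\frac{D\cos((n+1)\rho)+(B+2z_{0})\sin((n+1)\rho)}{D\cos(n\rho)+(B+2z_{0})\sin(n\rho)}\right)-B.$$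
   Context: The forbidden set $\mathfrak{F}$ of a second order rational difference equation is the set of initial conditions, written as pairs $(z_{0},z_{-1})\in\mathbb{C}^{2}$ in this order, for which the iteration eventually requires a division by zero (so that $z_n$ is not well defined for some $n\ge 1$; $0/0$ counts as undefined). $\mathbb{N}=\{1,2,3,\dots\}$, and $0^0=1$. $\sqrt{\cdot}$ is the principal complex square root, with branch cut along the negative real numbers; $\arccos$ is the usual real arccosine. In $Q_\delta$, an index $n$ for which the cotangent is undefined contributes no element.
   Formalization: In (a), z_n=0 is claimed for all n≥1, and for n=0 only if z_{-1}≠-B: as printed it fails for B=1, z_0=1, z_{-1}=-1, where C=0 and the pair is not forbidden, but z_0=1. *)

(* Defs.v *)
From mathcomp Require Import all_boot all_order all_algebra.
From mathcomp Require Import all_classical all_reals all_analysis.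
From mathcomp Require Import complex.

Set Implicit Arguments.
Unset Strict Implicit.
Unset Printing Implicit Defensive.

Import Order.TTheory GRing.Theory Num.Theory.

Local Open Scope classical_set_scope.
Local Open Scope complex_scope.
Local Open Scope ring_scope.

Section ForbiddenSet.
Variable F : fieldType.

(* Division with [None] for any zero denominator, [0 / 0] included. *)
Definition pdiv (x y : F) : option F := if y == 0 then None else Some (x / y).

(* [orbit f p n] is [Some (z_n, z_(n-1))] for the iteration
   z_(n+1) = f z_n z_(n-1) started at p = (z_0, z_(-1)), and [None] once some
   z_k with 1 <= k <= n fails to be defined. *)
Fixpoint orbit (f : F -> F -> option F) (p : F * F) (n : nat) :
    option (F * F) :=
  if n is m.+1 then
    if orbit f p m is Some (x, y) then omap (fun w => (w, x)) (f x y) else None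
  else Some p.

Definition zterm (f : F -> F -> option F) (p : F * F) (n : nat) : option F :=
  omap fst (orbit f p n).

Definition forbidden_set (f : F -> F -> option F) : set (F * F) :=
  [set p | exists2 n, (0 < n)%N & zterm f p n = None].

Definition ratmap (B x y : F) : option F := pdiv (x * y + B * x) (B + x).

End ForbiddenSet.

Section SolutionSets.
Variable R : realType.
Implicit Types (B delta : R[i]).

Definition real_itv (I : interval R) : set R[i] := [set x%:C | x in [set` I]].

(* The real arccosine at a complex number lying on the real axis. *)
Definition arccos (x : R[i]) : R := acos (complex.Re x).

(* [sqrtc] is the principal square root: nonnegative real part, and
   [sqrtc (- r%:C) = (Num.sqrt r) *i] for r >= 0. *)

(* For delta outside `]-oo, -1/4] and nonzero, Re s > 0, so that
   `|1 + s| > `|1 - s| and the quotient has a nonzero denominator. *)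
Definition Pset B delta : set R[i] :=
  let s := sqrtc (1 + 4 * delta) in
  [set a | exists2 n, (0 < n)%N &
    a = - 2 * delta * B
        * (((1 + s) ^+ n.-1 - (1 - s) ^+ n.-1) / ((1 + s) ^+ n - (1 - s) ^+ n))
        - B].

Definition Qset B delta : set R[i] :=
  let rho := arccos (1 / (2 * sqrtc (- delta))) in
  [set a | exists2 n, (0 < n)%N & sin (n%:R * rho) != 0 /\
    a = B / 2 * (- 1 - sqrtc (- 4 * delta - 1)
                       * (cos (n%:R * rho) / sin (n%:R * rho))%:C)].

Definition S5 B : set (R[i] * R[i]) :=
  [set (- B, - B)]
  `|` [set (a, B ^+ 2 / (- 4 * a) - B) | a in
        [set a | exists2 n, (0 < n)%N & a = (- B * n%:R - B) / (2 * n%:R)]]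
  `|` \bigcup_(delta in ~` (real_itv `]-oo, (- (1 / 4))] `|` [set 0]))
        [set (a, delta * B ^+ 2 / a - B) | a in Pset B delta `\ 0]
  `|` \bigcup_(delta in real_itv `]-oo, (- (1 / 4))[)
        [set (a, delta * B ^+ 2 / a - B) | a in Qset B delta `\ 0].

End SolutionSets.

(* Main.v *)
Require Import Defs.
From mathcomp Require Import all_boot all_order all_algebra.
From mathcomp Require Import all_classical all_reals all_analysis.
From mathcomp Require Import complex.
From mathcomp Require Import ring lra.

(** The map linearizes.  Put [w_n = z_n + B].  The equation reads
    [z_(n+1) * w_n = z_n * w_(n-1)], so this product keeps its initial value
    [C], and the second order equation becomes the Riccati equation
    [z_(n+1) = C / w_n].  Writing [w_n = B * u_(n+1) / u_n] turns it into the
    linear recurrence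
      [u_(n+2) = u_(n+1) + d * u_n],  [u_0 = 1],  [u_1 = (z_0 + B) / B],
    with [d = C / B ^ 2] ([denomseq]).  Induction on [n] ([orbit_ratmapE]) shows
    that [z_n] exists exactly as long as [u_1, ..., u_n] do not vanish.  Hence
    the initial pair is forbidden iff [u_n = 0] for some [n >= 1]
    ([forbidden_ratmapP]), and otherwise [z_n = B * u_(n+1) / u_n - B].

    Both halves of the theorem thus come from solving one linear recurrence,
    whose characteristic roots are those of [l ^ 2 = l + d].  Each solution
    formula gives a sequence that differs from [u] by a nonzero geometric factor
    ([rescales]), which affects neither the zeros nor, up to a constant, the
    quotients of consecutive terms.  The cases are
    - [d = 0]: [u] is constant from index [1] on, and it vanishes only for the
      pair [(- B, - B)];
    - [d = - 1 / 4]: a double root, so [u] is affine up to a geometric factor;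
    - [d] outside the ray from [- oo] to [- 1 / 4]: the principal root [s] of
      [1 + 4 * d] has positive real part, hence the two characteristic roots
      have different moduli ([expr_pm_neq]) and [u_n = 0] can be solved for
      [z_0];
    - [d < - 1 / 4]: the roots are [sqrt (- d)] times [exp (+/- i rho)] with
      [2 * sqrt (- d) * cos rho = 1], and [u_n = 0] prescribes the cotangent
      of [n * rho].
    Since [z_(-1)] is determined by [z_0] and [d] when [d != 0], these solutions
    are the pieces of the forbidden set. *)
Set Implicit Arguments.
Unset Strict Implicit.

Import Order.TTheory GRing.Theory Num.Theory.

Local Open Scope classical_set_scope.
Local Open Scope complex_scope.
Local Open Scope ring_scope.

(** * From the rational map to a linear recurrence *)
Section Linearization.
Context {F : fieldType}.
Implicit Types (d a c e B x y : F) (v : nat -> F).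

Fixpoint linrec d a (n : nat) : F :=
  if n is m.+1 then
    if m is k.+1 then linrec d a m + d * linrec d a k else a
  else 1.

Lemma linrecSS d a n : linrec d a n.+2 = linrec d a n.+1 + d * linrec d a n.
Proof. by []. Qed.

(** All closed forms are recognized through this lemma: the factor [e] is the
    rescaling that turns the characteristic roots of the recurrence into the
    ones that appear in the formula. *)
Lemma linrec_unique d a c e v :
  v 0%N = c -> v 1%N = c * e * a ->
  (forall n, v n.+2 = e * v n.+1 + d * e ^+ 2 * v n) ->
  forall n, v n = c * e ^+ n * linrec d a n.
Proof.
move=> v0 v1 vSS n.
suff [] : v n = c * e ^+ n * linrec d a n /\
          v n.+1 = c * e ^+ n.+1 * linrec d a n.+1 by [].
elim: n => [|n [IH1 IH2]].
  by rewrite v0 v1 /= expr0 expr1; split; ring.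
split=> //; rewrite vSS IH1 IH2 linrecSS !exprS; ring.
Qed.

(** The invariant [C] of the map, divided by [B ^ 2]. *)
Definition invariant_ratio B x y : F := (y + B) * x / B ^+ 2.

(** Denominators in the substitution [z_n + B = B * u_(n+1) / u_n]. *)
Definition denomseq B x y : nat -> F :=
  linrec (invariant_ratio B x y) ((x + B) / B).

(** The second component of the state is kept because the step uses the
    invariance of [z_n * (z_(n-1) + B)]; for [n = 0] this product contains the
    free initial value [y]. *)
Lemma orbit_ratmapE B x y n : B != 0 ->
  let u := denomseq B x y in
  Defs.orbit (ratmap B) (x, y) n =
  if [forall k : 'I_n.+1, u k != 0] then
    Some (B * (u n.+1 / u n) - B,
          if n is m.+1 then B * (u n / u m) - B else y)
  else None.
Proof.
move=> B0 u; elim: n => [|n IH].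
  rewrite /u /=; case: forallP => [_|[]]; last first.
    by move=> k; rewrite ord1 oner_neq0.
  by congr (Some (_, _)); rewrite /denomseq /= divr1; field.
rewrite [Defs.orbit _ _ n.+1]/= {}IH.
case: forallP => [u0|nu0]; last first.
  case: forallP => // u0; case: nu0 => k.
  exact: (u0 (widen_ord (leqnSn _) k)).
have un0 : u n != 0 by exact: (u0 ord_max).
set yn := (X in omap _ (ratmap _ _ X)).
(* The invariant, which turns the numerator of the map into a constant. *)
have Cn : (B * (u n.+1 / u n) - B) * (yn + B) = B ^+ 2 * invariant_ratio B x y.
  rewrite /yn; case: n @yn u0 un0 => [|m] /= u0 un0.
    by rewrite /u /denomseq /invariant_ratio /= divr1; field.
  have um0 : u m != 0 by exact: (u0 (Ordinal (leqnSn m.+1))).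
  rewrite /u /denomseq linrecSS -/(denomseq B x y) -/u.
  by field; rewrite um0 un0.
rewrite /ratmap /Defs.pdiv.
have -> : B + (B * (u n.+1 / u n) - B) = B * (u n.+1 / u n) by ring.
rewrite mulf_eq0 (negPf B0) /= mulf_eq0 invr_eq0 (negPf un0) orbF.
case: eqP => un1 /=.
  by case: forallP => // /(_ ord_max) /=; rewrite un1 eqxx.
case: forallP => [_|[k]]; last first.
  have [kn|] := ltnP k n.+1; first exact: (u0 (Ordinal kn)).
  move=> nk; have -> : k = n.+1 :> nat by apply/eqP; rewrite eqn_leq nk -ltnS ltn_ord.
  exact/eqP.
congr (Some (_, _)).
have -> : u n.+2 = u n.+1 + invariant_ratio B x y * u n by [].
move: Cn; set X := B * (u n.+1 / u n) - B => Cn.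
have -> : X * yn + B * X = X * (yn + B) by ring.
by rewrite Cn; move/eqP: un1 => un1; field; rewrite ?B0 ?un0 ?un1.
Qed.

Lemma denomseq_forall_neq0 B x y n :
  reflect (forall k, (k <= n)%N -> denomseq B x y k != 0)
          [forall k : 'I_n.+1, denomseq B x y k != 0].
Proof.
apply: (iffP forallP) => [u0 k kn|u0 k]; first exact: (u0 (Ordinal (kn : k < n.+1)%N)).
by apply: u0; rewrite -ltnS ltn_ord.
Qed.

Lemma forbidden_ratmapP B x y : B != 0 ->
  forbidden_set (ratmap B) (x, y) <->
  exists2 n, (0 < n)%N & denomseq B x y n = 0.
Proof.
move=> B0; split=> [[n n0]|[n n0 un]].
  rewrite /zterm orbit_ratmapE //; case: ifPn => // /forallPn[k].
  rewrite negbK => /eqP uk _; exists (nat_of_ord k) => //.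
  by case: (nat_of_ord k) uk => // /eqP; rewrite /denomseq /= oner_eq0.
exists n => //; rewrite /zterm orbit_ratmapE //.
by case: denomseq_forall_neq0 => // /(_ n (leqnn n)); rewrite un eqxx.
Qed.

Lemma admissible_denomseq_neq0 B x y n : B != 0 ->
  ~ forbidden_set (ratmap B) (x, y) -> denomseq B x y n != 0.
Proof.
move=> B0 adm; case: n => [|n]; first exact: oner_neq0.
by apply/eqP => un; apply: adm; apply/forbidden_ratmapP => //; exists n.+1.
Qed.

Lemma zterm_ratmapE B x y n : B != 0 -> ~ forbidden_set (ratmap B) (x, y) ->
  zterm (ratmap B) (x, y) n =
  Some (B * (denomseq B x y n.+1 / denomseq B x y n) - B).
Proof.
move=> B0 adm; rewrite /zterm orbit_ratmapE //.
case: denomseq_forall_neq0 => // [[]] k _; exact: admissible_denomseq_neq0.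
Qed.

(** Explicit solutions are only proportional to [denomseq], with a factor
    [c * e ^+ n]. This is enough: [c] and [e] being nonzero, zeros are the same,
    and quotients of consecutive terms change by the factor [e]. *)
Definition rescales B x y c e v :=
  [/\ c != 0, e != 0 & forall n, v n = c * e ^+ n * denomseq B x y n].

Lemma rescales_eq0 B x y c e v n : rescales B x y c e v ->
  (denomseq B x y n = 0) <-> (v n = 0).
Proof.
case=> c0 e0 ->; split=> [->|/eqP]; first by rewrite mulr0.
by rewrite mulf_eq0 mulf_eq0 (negPf c0) expf_eq0 (negPf e0) andbF /= => /eqP.
Qed.

Lemma rescales_ratio B x y c e v n : rescales B x y c e v ->
  denomseq B x y n != 0 ->
  v n != 0 /\ B * (denomseq B x y n.+1 / denomseq B x y n) - B
              = B / e * (v n.+1 / v n) - B.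
Proof.
move=> resc un; split; first by apply: contra un => /eqP/(rescales_eq0 n resc)->.
case: resc => c0 e0 vE; rewrite !vE exprS.
have en : e ^+ n != 0 by rewrite expf_neq0.
by field; rewrite un en e0 c0.
Qed.

End Linearization.

(** * Closed forms over a numeric field *)
Section ClosedForms.
Context {F : numFieldType}.
Implicit Types (B x y s : F).

(** For the double root [1 / 2], the factor [2 ^+ n] moves the root to [1], and
    the solutions become affine in [n]. *)
Lemma double_root_rescales B x y : B != 0 -> invariant_ratio B x y = - (1 / 4) ->
  rescales B x y (2 * B) 2 (fun n => 2 * B + 4 * n%:R * x + 2 * n%:R * B).
Proof.
move=> B0 dE; split; rewrite ?mulf_neq0 ?pnatr_eq0 //.
apply: linrec_unique => [||n]; first by ring.
  by field.
by rewrite dE -!natr1; field.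
Qed.

Lemma distinct_roots_rescales B x y s : B != 0 -> s != 0 ->
  s ^+ 2 = 1 + 4 * invariant_ratio B x y ->
  let l1 := (1 - s) / 2 in let l2 := (1 + s) / 2 in
  rescales B x y (B * s) 1
    (fun n => (B * l2 - x - B) * l1 ^+ n + (x + B - B * l1) * l2 ^+ n).
Proof.
move=> B0 s0 sE l1 l2; split; rewrite ?mulf_neq0 ?oner_neq0 //.
have dE : invariant_ratio B x y = (s ^+ 2 - 1) / 4 by rewrite sE; field.
apply: linrec_unique => [||n]; rewrite /l1 /l2.
- by field.
- by field.
- by rewrite dE !exprS; field.
Qed.

(** Since [l1 * l2] is minus the invariant ratio, the equation is affine in [x]
    with leading coefficient [l2 ^+ n - l1 ^+ n]. The index is a successor
    because the constant term involves the powers of order [n - 1]. *)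
Lemma distinct_roots_eq0 B x y s m : B != 0 ->
  s ^+ 2 = 1 + 4 * invariant_ratio B x y ->
  (1 + s) ^+ m.+1 - (1 - s) ^+ m.+1 != 0 ->
  let l1 := (1 - s) / 2 in let l2 := (1 + s) / 2 in
  (B * l2 - x - B) * l1 ^+ m.+1 + (x + B - B * l1) * l2 ^+ m.+1 = 0 <->
  x = - 2 * invariant_ratio B x y * B
      * (((1 + s) ^+ m - (1 - s) ^+ m) / ((1 + s) ^+ m.+1 - (1 - s) ^+ m.+1)) - B.
Proof.
move=> B0 sE D0 l1 l2.
have dE : invariant_ratio B x y = (s ^+ 2 - 1) / 4 by rewrite sE; field.
set D := _ - _ in D0 *; set N := (1 + s) ^+ m - (1 - s) ^+ m.
have -> : (B * l2 - x - B) * l1 ^+ m.+1 + (x + B - B * l1) * l2 ^+ m.+1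
    = D / 2 ^+ m.+1 * (x - (- 2 * invariant_ratio B x y * B * (N / D) - B)).
  rewrite dE; apply: (@eq_trans _ _
    ((D * (x + B) + 2 * ((s ^+ 2 - 1) / 4) * B * N) / 2 ^+ m.+1)).
    by rewrite /l1 /l2 /N /D !exprMn !exprVn !exprS; field.
  by field; rewrite D0 expf_neq0 ?pnatr_eq0.
split=> /eqP; last by rewrite -subr_eq0 => /eqP->; rewrite mulr0.
rewrite mulf_eq0 mulf_eq0 invr_eq0 (negPf D0) expf_eq0 pnatr_eq0 andbF /=.
by rewrite subr_eq0 => /eqP.
Qed.

End ClosedForms.

(** * The two regimes of a complex parameter *)
Section ComplexParameters.
Context {R : realType}.
Implicit Types (B delta x y : R[i]) (t : R).

Lemma Re_sqrtc_ge0 (w : R[i]) : 0 <= complex.Re (sqrtc w).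
Proof. by case: w => a b /=; rewrite sqrtr_ge0. Qed.

(** The principal square root of a complex number has nonnegative real part; if
    this part is zero, the number is the opposite of a real square. *)
Lemma Re_sqrtc_gt0 delta : ~ real_itv `]-oo, (- (1 / 4))] delta ->
  0 < complex.Re (sqrtc (1 + 4 * delta)).
Proof.
move=> dN; rewrite lt_neqAle Re_sqrtc_ge0 andbT eq_sym; apply/eqP => re0; apply: dN.
have := sqr_sqrtc (1 + 4 * delta).
case: (sqrtc _) re0 => a b /= -> sE.
exists (- ((1 + b ^+ 2) / 4)).
  by rewrite /= in_itv /=; have := sqr_ge0 b; lra.
have -> : delta = ((0 +i* b) ^+ 2 - 1) / 4 by rewrite sE; field.
rewrite (_ : (0 +i* b) ^+ 2 = (- b ^+ 2)%:C); last first.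
  by rewrite expr2; simpc; rewrite expr2.
rewrite !(rmorphN, rmorphM, rmorphD, rmorph1, fmorphV, rmorphXn, rmorph_nat) /=.
by field.
Qed.

(** The squared moduli of [1 + s] and [1 - s] differ by four times the real part
    of [s], and equal powers would force equal moduli. *)
Lemma expr_pm_neq (s : R[i]) n : 0 < complex.Re s -> (0 < n)%N ->
  (1 + s) ^+ n - (1 - s) ^+ n != 0.
Proof.
move=> s0 n0; rewrite subr_eq0; apply/eqP => /(congr1 Num.norm).
rewrite !normrX => /eqP; rewrite eqrXn2 // => /eqP/(congr1 (fun z => z ^+ 2)).
rewrite !sqr_normc !(rmorphB, rmorphD, rmorph1) => /eqP; rewrite -subr_eq0.
rewrite (_ : _ - _ = 2 * (s + s^*%C)); last by ring.
rewrite addcJ mulrA mulf_eq0 -natrM pnatr_eq0 /= => /eqP[] se.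
by rewrite se ltxx in s0.
Qed.

Lemma real_itvNE delta t :
  real_itv `]-oo, t] delta <-> real_itv `[(- t), +oo[ (- delta).
Proof.
split=> -[r]; rewrite /= in_itv /= ?andbT => rt rE; exists (- r).
- by rewrite /= in_itv /= andbT lerN2.
- by rewrite -rE rmorphN.
- by rewrite /= in_itv /= lerNl.
- by rewrite rmorphN /= rE opprK.
Qed.

(** For [1 / 4 < t], the numbers [sqrt t * (cos rho +/- i sin rho)] are the roots
    [(1 +/- i sqrt (4 * t - 1)) / 2] of [l ^+ 2 = l - t]. *)
Lemma cos_acos_half_sqrt t : 1 / 4 < t ->
  let rho := acos (1 / (2 * Num.sqrt t)) in
  2 * Num.sqrt t * cos rho = 1 /\
  2 * Num.sqrt t * sin rho = Num.sqrt (4 * t - 1).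
Proof.
move=> ht rho.
have t0 : 0 < t by lra.
have r0 : 0 < Num.sqrt t by rewrite sqrtr_gt0.
have rE : Num.sqrt t ^+ 2 = t by rewrite sqr_sqrtr // ltW.
have r1 : 1 < 2 * Num.sqrt t by nra.
have p0 : 0 < 2 * Num.sqrt t by lra.
have bnd : -1 <= 1 / (2 * Num.sqrt t) <= 1.
  apply/andP; split; last by rewrite ler_pdivrMr // mul1r ltW.
  by apply: (@le_trans _ _ 0); rewrite ?lerN10 // divr_ge0 // ltW.
split; first by rewrite acosK ?in_itv //= div1r mulfV // gt_eqF.
rewrite sin_acos // -{1}(ger0_norm (ltW p0)) -sqrtr_sqr -sqrtrM ?sqr_ge0 //.
by congr Num.sqrt; rewrite -[in RHS]rE; field; rewrite gt_eqF.
Qed.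

(** Dividing by [sqrt t] puts the conjugate roots on the unit circle, and the
    recurrence becomes the addition formula
    [f (n + 2) = 2 cos rho * f (n + 1) - f n] satisfied by the cosine and the
    sine of [n * rho]. *)
Lemma conjugate_roots_rescales B x y t : B != 0 -> 1 / 4 < t ->
  invariant_ratio B x y = - t%:C ->
  let rho := acos (1 / (2 * Num.sqrt t)) in
  rescales B x y (B * (Num.sqrt (4 * t - 1))%:C) ((Num.sqrt t)^-1)%:C
    (fun n => B * (Num.sqrt (4 * t - 1))%:C * (cos (n%:R * rho))%:C
              + (B + 2 * x) * (sin (n%:R * rho))%:C).
Proof.
move=> B0 ht dE rho; have [cE sE] := cos_acos_half_sqrt ht; rewrite -/rho in cE sE.
have t0 : 0 < t by lra.
have r0 : Num.sqrt t != 0 by rewrite gt_eqF // sqrtr_gt0.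
have rE : Num.sqrt t ^+ 2 = t by rewrite sqr_sqrtr // ltW.
have s0 : Num.sqrt (4 * t - 1) != 0 by rewrite gt_eqF // sqrtr_gt0; lra.
have cV : (Num.sqrt t)^-1 = 2 * cos rho.
  by apply: (mulfI r0); rewrite mulfV // mulrCA mulrA cE.
split.
- by rewrite mulf_neq0 // fmorph_eq0.
- by rewrite fmorph_eq0 invr_eq0.
apply: linrec_unique => [||n].
- by rewrite !mul0r cos0 sin0 rmorph1 rmorph0; ring.
- rewrite !mul1r -sE cV !rmorphM /= rmorph_nat.
  move: (congr1 (real_complex R) cE); rewrite !rmorphM /= rmorph1 rmorph_nat => cE'.
  (* Both sides are completed with the factor [2 * sqrt t * cos rho = 1]. *)
  move: (real_complex R (sin rho)) (real_complex R (cos rho)) cE' => S c cE'.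
  rewrite [LHS](_ : _ = B * S * (2 * (Num.sqrt t)%:C * c) + (B + 2 * x) * S); last by ring.
  rewrite [RHS](_ : _ = 2 * S * (x + B) * (2 * (Num.sqrt t)%:C * c)); last by field.
  by rewrite cE'; ring.
have cSS : cos (n.+2%:R * rho) = 2 * cos rho * cos (n.+1%:R * rho) - cos (n%:R * rho).
  rewrite (_ : n.+2%:R * rho = n.+1%:R * rho + rho); last by rewrite -natr1; ring.
  rewrite (_ : n%:R * rho = n.+1%:R * rho - rho); last by rewrite -[n.+1%:R]natr1; ring.
  by rewrite cosD cosB; ring.
have sSS : sin (n.+2%:R * rho) = 2 * cos rho * sin (n.+1%:R * rho) - sin (n%:R * rho).
  rewrite (_ : n.+2%:R * rho = n.+1%:R * rho + rho); last by rewrite -natr1; ring.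
  rewrite (_ : n%:R * rho = n.+1%:R * rho - rho); last by rewrite -[n.+1%:R]natr1; ring.
  by rewrite sinD sinB; ring.
have -> : invariant_ratio B x y * (Num.sqrt t)^-1%:C ^+ 2 = -1.
  rewrite dE (_ : t%:C = (Num.sqrt t)%:C ^+ 2); last by rewrite -rmorphXn /= rE.
  by rewrite fmorphV mulNr exprVn mulfV // expf_neq0 // fmorph_eq0.
rewrite cV cSS sSS !(rmorphB, rmorphM) /=; ring.
Qed.

End ComplexParameters.

(** * The forbidden set *)
Section ForbiddenSet.
Context {R : realType}.
Implicit Types (B delta x y : R[i]) (t : R).

Lemma pole_zero_ratio B x y : B != 0 -> invariant_ratio B x y = 0 ->
  (exists2 n, (0 < n)%N & denomseq B x y n = 0) <-> (x, y) = (- B, - B).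
Proof.
move=> B0 dE.
have constu n : denomseq B x y n.+1 = (x + B) / B.
  by elim: n => [//|n IH]; rewrite /denomseq linrecSS -/(denomseq B x y) IH dE mul0r addr0.
split=> [[[//|n] _]|[xE _]]; last by exists 1%N; rewrite ?constu ?xE ?addNr ?mul0r.
move=> /eqP; rewrite constu mulf_eq0 invr_eq0 (negPf B0) orbF addr_eq0 => /eqP xE.
move/eqP: dE; rewrite xE /invariant_ratio mulf_eq0 invr_eq0 expf_eq0 (negPf B0) andbF orbF.
by rewrite mulf_eq0 oppr_eq0 (negPf B0) orbF addr_eq0 => /eqP ->.
Qed.

Lemma pole_double_root B x y : B != 0 -> invariant_ratio B x y = - (1 / 4) ->
  (exists2 n, (0 < n)%N & denomseq B x y n = 0) <->
  (exists2 n, (0 < n)%N & x = (- B * n%:R - B) / (2 * n%:R)).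
Proof.
move=> B0 dE; have resc := double_root_rescales B0 dE.
suff key n : (0 < n)%N ->
    denomseq B x y n = 0 <-> x = (- B * n%:R - B) / (2 * n%:R).
  by split=> -[n n0 /(key n n0)]; exists n.
move=> n0; rewrite (rescales_eq0 n resc).
have nC : n%:R != 0 :> R[i] by rewrite pnatr_eq0 -lt0n.
have -> : 2 * B + 4 * n%:R * x + 2 * n%:R * B =
          4 * n%:R * (x - (- B * n%:R - B) / (2 * n%:R)) by field.
split=> /eqP; last by rewrite -subr_eq0 => /eqP->; rewrite mulr0.
by rewrite mulf_eq0 mulf_eq0 pnatr_eq0 (negPf nC) /= subr_eq0 => /eqP.
Qed.

Lemma pole_distinct_roots B x y : B != 0 ->
  ~ real_itv `]-oo, (- (1 / 4))] (invariant_ratio B x y) ->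
  (exists2 n, (0 < n)%N & denomseq B x y n = 0) <->
  Pset B (invariant_ratio B x y) x.
Proof.
move=> B0 /Re_sqrtc_gt0; set s := sqrtc _ => s0.
have sE : s ^+ 2 = 1 + 4 * invariant_ratio B x y by exact: sqr_sqrtc.
have snz : s != 0 by apply/eqP => sz; rewrite sz ltxx in s0.
have resc := distinct_roots_rescales B0 snz sE.
suff key n : (0 < n)%N -> denomseq B x y n = 0 <->
    x = - 2 * invariant_ratio B x y * B
        * (((1 + s) ^+ n.-1 - (1 - s) ^+ n.-1) / ((1 + s) ^+ n - (1 - s) ^+ n)) - B.
  by split=> -[n n0 /(key n n0)]; exists n.
case: n => // m _; rewrite (rescales_eq0 m.+1 resc).
exact: distinct_roots_eq0 (expr_pm_neq s0 (ltn0Sn m)).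
Qed.

(** On the ray of real parameters below [- 1 / 4], the complex square roots and
    the arccosine are values of the real functions. *)
Lemma neg_real_parameters t : 1 / 4 < t ->
  arccos (1 / (2 * sqrtc (- - t%:C))) = acos (1 / (2 * Num.sqrt t)) /\
  sqrtc (- 4 * - t%:C - 1) = (Num.sqrt (4 * t - 1))%:C.
Proof.
move=> ht; split.
  rewrite opprK sqrtc_sqrtr ?ler0c /=; last by lra.
  rewrite (_ : 1 / _ = (1 / (2 * Num.sqrt t))%:C) //.
  by rewrite !div1r fmorphV rmorphM /= rmorph_nat.
rewrite (_ : _ - 1 = (4 * t - 1)%:C).
  by rewrite sqrtc_sqrtr // ler0c; lra.
by rewrite rmorphB rmorphM /= rmorph1 rmorph_nat; ring.
Qed.

Lemma pole_conjugate_roots B x y t : B != 0 -> 1 / 4 < t ->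
  invariant_ratio B x y = - t%:C ->
  (exists2 n, (0 < n)%N & denomseq B x y n = 0) <->
  Qset B (invariant_ratio B x y) x.
Proof.
move=> B0 ht dE; have resc := conjugate_roots_rescales B0 ht dE.
have [rhoE sE] := neg_real_parameters ht.
rewrite /Qset dE rhoE sE; set rho := acos _ in resc *; set s := Num.sqrt _ in resc *.
have s0 : s != 0 by rewrite gt_eqF // sqrtr_gt0; lra.
suff key n : denomseq B x y n = 0 <-> sin (n%:R * rho) != 0 /\
    x = B / 2 * (- 1 - s%:C * (cos (n%:R * rho) / sin (n%:R * rho))%:C).
  by split=> -[n n0 /(key n)]; exists n.
rewrite (rescales_eq0 n resc) fmorph_div.
set c := cos _; set d := sin _.
have cd : c ^+ 2 + d ^+ 2 = 1 by exact: cos2Dsin2.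
have dC : (d%:C == 0) = (d == 0) by rewrite fmorph_eq0.
split=> [vn|[d0 ->]]; last by field; rewrite dC.
have d0 : d != 0.
  (* Where the sine vanishes the cosine does not, so the cosine term of the
     solution remains: indices without a cotangent give no zero. *)
  apply/eqP => dz; move/eqP: vn; rewrite dz mulr0 addr0 !mulf_eq0 (negPf B0) /=.
  rewrite !fmorph_eq0 (negPf s0) /= => /eqP cz; move/eqP: cd.
  by rewrite cz dz !expr0n /= addr0 eq_sym oner_eq0.
split=> //; have d0C : d%:C != 0 by rewrite dC.
apply: (mulIf d0C); apply: (@mulfI _ 2); first by rewrite pnatr_eq0.
apply/eqP; rewrite -subr_eq0 -vn; apply/eqP; field; exact: d0C.
Qed.

(** Once the invariant ratio is fixed and nonzero, the second coordinate of an
    initial pair is a function of the first one, which cannot be zero. *)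
Lemma fiberP B delta (A : set R[i]) x y : B != 0 -> delta != 0 ->
  [set (a, delta * B ^+ 2 / a - B) | a in A `\ 0] (x, y) <->
  A x /\ delta = invariant_ratio B x y.
Proof.
move=> B0 d0; split=> [[a [Aa /eqP a0]]|[Ax dE]].
  by case=> <- <-; split=> //; rewrite /invariant_ratio; field; rewrite a0 B0.
have x0 : x != 0.
  by apply: contra d0; rewrite dE /invariant_ratio => /eqP->; rewrite mulr0 mul0r.
exists x; first by split=> //; apply/eqP.
by congr (_, _); rewrite dE /invariant_ratio; field; rewrite x0 B0.
Qed.

Lemma forbidden_setE B : B != 0 -> forbidden_set (ratmap B) = S5 B.
Proof.
move=> B0; apply/seteqP; split=> -[x y].
  move=> /(forbidden_ratmapP _ _ B0) pole.
  have [d0|d0] := eqVneq (invariant_ratio B x y) 0.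
    by left; left; left; apply/(pole_zero_ratio B0 d0).
  have [dI|dN] := pselect (real_itv `]-oo, (- (1 / 4))] (invariant_ratio B x y)); last first.
    left; right; exists (invariant_ratio B x y); first by case=> // /eqP; apply/negP.
    by apply/fiberP => //; split=> //; apply/pole_distinct_roots.
  have [r] := dI; rewrite /= in_itv /= le_eqVlt => /orP[/eqP -> dE|rlt dE].
    have dE' : invariant_ratio B x y = - (1 / 4).
      by rewrite -dE rmorphN fmorph_div rmorph1 rmorph_nat.
    left; left; right; exists x; first by apply/(pole_double_root B0 dE').
    have x0 : x != 0.
      by apply: contra d0; rewrite /invariant_ratio => /eqP->; rewrite mulr0 mul0r.
    have -> : y = invariant_ratio B x y * B ^+ 2 / x - B.
      by rewrite /invariant_ratio; field; rewrite x0 B0.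
    by congr (_, _); rewrite dE'; field.
  right; exists (invariant_ratio B x y); first by exists r => //=; rewrite in_itv.
  apply/fiberP => //; split=> //.
  apply/(pole_conjugate_roots (t := - r)) => //; first by lra.
  by rewrite -dE rmorphN opprK.
move=> S5xy; apply/(forbidden_ratmapP _ _ B0); case: S5xy => [[[|]|]|].
- move=> xyE; apply/pole_zero_ratio => //; case: xyE => -> ->.
  by rewrite /invariant_ratio addNr !mul0r.
- move=> [a [n n0 aE] [<- <-]].
  have a0 : a != 0.
    have nC : n%:R != 0 :> R[i] by rewrite pnatr_eq0 -lt0n.
    rewrite aE (_ : - B * n%:R - B = - B * n.+1%:R); last by rewrite -natr1; ring.
    by rewrite !mulf_neq0 ?invr_eq0 ?mulf_neq0 ?oppr_eq0 ?nC ?pnatr_eq0.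
  apply/pole_double_root => //; last by exists n.
  by rewrite /invariant_ratio; field; rewrite a0 B0.
- move=> [d dN /fiberP[]//].
    by apply/eqP => dz; apply: dN; right.
  by move=> Px dE; apply/pole_distinct_roots => //; rewrite -?dE // => dI; apply: dN; left.
- move=> [d [r]]; rewrite /= in_itv /= => rlt rE /fiberP[]//.
    by rewrite -rE fmorph_eq0; apply/eqP; lra.
  move=> Qx dE; apply/(pole_conjugate_roots (t := - r)) => //; rewrite -?dE //.
    by lra.
  by rewrite -rE rmorphN opprK.
Qed.

End ForbiddenSet.

(** * Forbidden set and solutions *)
Theorem theorem6 (R : realType) (B : R[i]) (hB : B != 0) :
  forbidden_set (ratmap B) = S5 B /\
  forall z0 zm1 : R[i], ~ forbidden_set (ratmap B) (z0, zm1) ->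
  let C := (zm1 + B) * z0 in
  exists z : nat -> R[i],
  [/\ (forall n, zterm (ratmap B) (z0, zm1) n = Some (z n)),
      (forall n, z n + B != 0 /\ z n.+1 = C / (z n + B)) &
  [/\ (* (a) *)
      C = 0 ->
        (forall n, z n.+1 = 0) /\ (zm1 != - B -> forall n, z n = 0),
      (* (b) *)
      (~` real_itv `[1 / 4, +oo[) (- C / B ^+ 2) ->
        let l1 := (1 - sqrtc (1 + 4 * C / B ^+ 2)) / 2 in
        let l2 := (1 + sqrtc (1 + 4 * C / B ^+ 2)) / 2 in
        let X n := (B * l2 - z0 - B) * l1 ^+ n + (z0 + B - B * l1) * l2 ^+ n in
        forall n, X n != 0 /\ z n = B * (X n.+1 / X n) - B,
      (* (c) *)
      - C / B ^+ 2 = 1 / 4 ->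
        forall n,
          2 * B + 4 * n%:R * z0 + 2 * n%:R * B != 0 /\
          z n = B * ((B + n.+1%:R * (2 * z0 + B))
                     / (2 * B + 4 * n%:R * z0 + 2 * n%:R * B)) - B &
      (* (d) *)
      real_itv `]1 / 4, +oo[ (- C / B ^+ 2) ->
        let D := B * sqrtc (- 4 * C / B ^+ 2 - 1) in
        let rho := arccos (sqrtc (B ^+ 2 / (- 4 * C))) in
        let X n := D * (cos (n%:R * rho))%:C
                   + (B + 2 * z0) * (sin (n%:R * rho))%:C in
        forall n, X n != 0 /\
          z n = B * sqrtc (- C / B ^+ 2) * (X n.+1 / X n) - B ]].
Proof.
split; first exact: forbidden_setE.
move=> z0 zm1 adm C.
have un n := admissible_denomseq_neq0 n hB adm.
pose z n := B * (denomseq B z0 zm1 n.+1 / denomseq B z0 zm1 n) - B.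
have CE : C / B ^+ 2 = invariant_ratio B z0 zm1 by [].
have wE n : z n + B = B * (denomseq B z0 zm1 n.+1 / denomseq B z0 zm1 n).
  by rewrite /z addrNK.
have zrec n : z n + B != 0 /\ z n.+1 = C / (z n + B).
  rewrite wE; split; first by rewrite !mulf_neq0 ?invr_eq0.
  rewrite /z (_ : denomseq _ _ _ n.+2 = denomseq B z0 zm1 n.+1
      + invariant_ratio B z0 zm1 * denomseq B z0 zm1 n) // -CE.
  by field; rewrite hB !un.
exists z; split=> //; first by move=> n; exact: zterm_ratmapE.
split.
- move=> C0; have zS n : z n.+1 = 0 by rewrite (zrec n).2 C0 mul0r.
  split=> // zm1B [|n]; last exact: zS.
  (* At [n = 0] the Riccati form says nothing: [z0 = 0] comes from the
     vanishing of the product [C] itself. *)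
  rewrite /z /denomseq /= divr1 mulrC divfK // addrK.
  by move/eqP: C0; rewrite /C mulf_eq0 addr_eq0 (negPf zm1B) => /eqP.
- rewrite mulNr CE -mulrA CE => hC l1 l2 X n.
  have s0 : 0 < complex.Re (sqrtc (1 + 4 * invariant_ratio B z0 zm1)).
    by apply: Re_sqrtc_gt0 => /real_itvNE; rewrite opprK.
  have snz : sqrtc (1 + 4 * invariant_ratio B z0 zm1) != 0.
    by apply/eqP => sz; rewrite sz ltxx in s0.
  have resc := distinct_roots_rescales hB snz (sqr_sqrtc _).
  by have := rescales_ratio resc (un n); rewrite divr1.
- rewrite mulNr CE => dE n.
  have {}dE : invariant_ratio B z0 zm1 = - (1 / 4) by rewrite -dE opprK.
  have resc := double_root_rescales hB dE.
  have [vn zE] := rescales_ratio resc (un n).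
  split=> //; rewrite /z zE -natr1; congr (_ - _); field; exact: vn.
- rewrite (mulNr C) CE => -[t]; rewrite /= in_itv /= andbT => ht tE.
  have {}tE : invariant_ratio B z0 zm1 = - t%:C by rewrite tE opprK.
  have resc := conjugate_roots_rescales hB ht tE.
  have [rhoE sE] := neg_real_parameters ht.
  have t0 : 0 < t by lra.
  have tC0 : t%:C != 0 by rewrite fmorph_eq0 gt_eqF.
  have CE' : C = - t%:C * B ^+ 2 by rewrite -tE -CE divfK // expf_neq0.
  have sqrt_inv : sqrtc (B ^+ 2 / (- 4 * C)) = 1 / (2 * sqrtc (- - t%:C)).
    rewrite opprK (_ : B ^+ 2 / _ = (1 / (4 * t))%:C); last first.
      by rewrite fmorph_div rmorphM rmorph1 rmorph_nat /= CE'; field; rewrite hB tC0.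
    rewrite !sqrtc_sqrtr ?ler0c //= ?divr_ge0 ?mulr_ge0 ?ltW //.
    rewrite !div1r sqrtrV ?mulr_ge0 ?ltW // sqrtrM // fmorphV.
    rewrite (_ : (4 : R) = 2 ^+ 2) ?sqrtr_sqr ?ger0_norm // ?rmorphM ?rmorph_nat //.
    by rewrite -natrX.
  rewrite -mulrA CE tE sqrt_inv rhoE sE => n.
  have [Xn zE] := rescales_ratio resc (un n).
  split=> //; rewrite /z zE fmorphV invrK opprK.
  by rewrite sqrtc_sqrtr ?ler0c // ltW.
Qed.
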